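(* Assume in addition that $l$ is $\mu$-strongly convex on $\mathcal{X}$ for some $\mu>0$. Consider SPDHG (as in the context) run with step-sizes $\beta^{k+1} = \frac{2}{\mu(k+2)+2L}$ and non-uniform weights $\alpha^{k+1}=\frac{2(k+1)}{(t+1)(t+2)}$, $k=0,\dots,t$. Let $(y^*,x^* )$ be any saddle point of $\min_{x\in\mathcal{X}}\max_{y\in\mathcal{Y}}P(y,x)$. Then for every $t\ge0$, $$0\le\mathbb{E}\left[P(y^*,\bar{x}^t) - P(\bar{y}^t,x^* )\right] \le \frac{D_y^2}{s(t+2)} + \frac{L D_x^2}{t+2} + \frac{4\lambda_{\max}(F^\top F)D_y^2+4\sigma^2}{\mu(t+2)},$$ i.e. convergence at rate $O(1/t)$ in expectation.
   Context: Setting: $\mathcal{X}\subset\mathbb{R}^d$ is a nonempty convex compact set with diameter $D_x$ (so $\|x-x'\|\le D_x$ for all $x,x'\in\mathcal{X}$), $\mathcal{Y}\subset\mathbb{R}^l$ is a nonempty convex compact set with diameter $D_y$, $F\in\mathbb{R}^{l\times d}$, and $\lambda_{\max}(F^\top F)$ denotes the largest eigenvalue of $F^\top F$. The loss is $l(x)=\mathbb{E}_\xi[l(x,\xi)]$, a convex, continuously differentiable function on $\mathcal{X}$ with $L$-Lipschitz gradient: $\|\nabla l(x_1)-\nabla l(x_2)\|\le L\|x_1-x_2\|$ for all $x_1,x_2\in\mathcal{X}$. $\mu$-strong convexity means $l(y)-l(x)-(y-x)^\top\nabla l(x)\ge\frac{\mu}{2}\|y-x\|^2$ for all $x,y\in\mathcal{X}$.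 The stochastic gradient $\nabla l(x,\xi)$ satisfies, for every $x\in\mathcal{X}$: $\mathbb{E}[\nabla l(x,\xi)]=\nabla l(x)$, $\mathbb{E}\|\nabla l(x,\xi)-\nabla l(x)\|^2\le\sigma^2$, and $\mathbb{E}\exp\left(\|\nabla l(x,\xi)-\nabla l(x)\|^2/\sigma^2\right)\le \exp(1)$, for a constant $\sigma>0$. The saddle function is $P(y,x)=l(x)+\langle y,Fx\rangle$ for $x\in\mathcal{X},y\in\mathcal{Y}$; a saddle point $(y^*,x^* )$ satisfies $P(y,x^* )\le P(y^*,x^* )\le P(y^*,x)$ for all $(y,x)\in\mathcal{Y}\times\mathcal{X}$ (assumed to exist). SPDHG: fix $s>0$, $x^0\in\mathcal{X}$, $y^0\in\mathcal{Y}$, and a sequence of step-sizes $\beta^{k+1}>0$. For $k=0,1,2,\dots$, draw a sample $\xi^{k+1}$ independently of the past (i.i.d. samples), and set $$y^{k+1}=\arg\max_{y\in\mathcal{Y}}\Big\{P(y,x^k)-\tfrac{1}{2s}\|y-y^k\|^2\Big\},\qquad x^{k+1}=\Pi_{\mathcal{X}}\Big[x^k-\beta^{k+1}\big(\nabla l(x^k,\xi^{k+1})+F^\top y^{k+1}\big)\Big],$$ where $\Pi_{\mathcal{X}}$ is Euclidean projection onto $\mathcal{X}$. Given weights $\alpha^{k+1}\ge0$ with $\sum_{k=0}^t\alpha^{k+1}=1$, the output after $t$ steps is $\bar x^t=\sum_{k=0}^t\alpha^{k+1}x^{k+1}$, $\bar y^t=\sum_{k=0}^t\alpha^{k+1}y^{k+1}$.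 *)

(* Defs.v *)
From mathcomp Require Import all_boot all_order all_algebra.
From mathcomp Require Import all_classical all_reals all_analysis.
Import Order.TTheory GRing.Theory Num.Theory.
Import numFieldNormedType.Exports.

Set Implicit Arguments.
Unset Strict Implicit.
Unset Printing Implicit Defensive.

Local Open Scope classical_set_scope.
Local Open Scope ring_scope.

Section Defs.
Variable R : realType.

(* Euclidean inner product and Euclidean norm on column vectors R^n
   (the library's norm on matrices is the max-norm, so we define these). *)
Definition dotv (n : nat) (u v : 'cV[R]_n) : R := \sum_(i < n) u i 0 * v i 0.
Definition enorm (n : nat) (u : 'cV[R]_n) : R := Num.sqrt (dotv u u).

Definition diam (n : nat) (S : set 'cV[R]_n) : R :=
  sup [set r | exists x x', [/\ S x, S x' & r = enorm (x - x')]].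

Definition convex_on (n : nat) (S : set 'cV[R]_n) (f : 'cV[R]_n -> R) : Prop :=
  forall x y, S x -> S y -> forall th : R, 0 <= th <= 1 ->
    f (th *: x + (1 - th) *: y) <= th * f x + (1 - th) * f y.

Definition strongly_convex_on (n : nat) (S : set 'cV[R]_n)
  (f : 'cV[R]_n -> R) (gradf : 'cV[R]_n -> 'cV[R]_n) (mu : R) : Prop :=
  forall x y, S x -> S y ->
    f y - f x - dotv (y - x) (gradf x) >= mu / 2 * enorm (y - x) ^+ 2.

Definition gradient_on (n : nat) (S : set 'cV[R]_n)
  (f : 'cV[R]_n -> R) (gradf : 'cV[R]_n -> 'cV[R]_n) : Prop :=
  forall x, S x -> differentiable f x /\ forall h, 'd f x h = dotv (gradf x) h.

Definition is_argmax (T : Type) (S : set T) (f : T -> R) (p : T) : Prop :=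
  S p /\ forall q, S q -> f q <= f p.
Definition is_argmin (T : Type) (S : set T) (f : T -> R) (p : T) : Prop :=
  S p /\ forall q, S q -> f p <= f q.

Definition is_proj (n : nat) (S : set 'cV[R]_n) (z p : 'cV[R]_n) : Prop :=
  is_argmin S (fun q => enorm (q - z)) p.

Definition lambda_max (n : nat) (A : 'M[R]_n) : R :=
  sup [set a : R | eigenvalue A a].

Definition saddleP (d l : nat) (loss : 'cV[R]_d -> R) (F : 'M[R]_(l, d))
  (y : 'cV[R]_l) (x : 'cV[R]_d) : R := loss x + dotv y (F *m x).

(* Column vector from a tuple (to use the product sigma-algebra of tuples). *)
Definition cv_of_tuple (n : nat) (t : n.-tuple R) : 'cV[R]_n :=
  \col_(i < n) tnth t i.

End Defs.

Definition mutually_independent (R : realType) (dO dX : measure_display)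
  (Omega : measurableType dO) (Xi : measurableType dX)
  (P : probability Omega R) (xi : nat -> Omega -> Xi) : Prop :=
  forall (s : seq nat) (A : nat -> set Xi), uniq s ->
    (forall k, measurable (A k)) ->
    P (\bigcap_(k in [set k | k \in s]) (xi k @^-1` A k)) =
    (\prod_(k <- s) P (xi k @^-1` A k))%E.

(* Main.v *)
(* One step of the method.  The optimality conditions of the two projections,
   the descent lemma with constant L / 2 and strong convexity bound the gap
   P(ys, x^{k+1}) - P(y^{k+1}, xs) by the telescoping differences of
   |ys - y^k|^2 / (2 s) and (mu (k+2) / 4 + L / 2) |xs - x^k|^2, minus
   mu / 2 |xs - x^k|^2, minus <delta, x^k - xs> with delta the gradient noise,
   plus the cross terms <ys - y^{k+1}, F (x^{k+1} - x^k)> and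
   - <delta, x^{k+1} - x^k>.  Young's inequality absorbs the cross terms into
   mu (k+2) / 4 |x^{k+1} - x^k|^2, the part of 1 / (2 beta) left over by the
   descent lemma.  With weights k + 1 the coefficient of |xs - x^k|^2 becomes
   mu / 4 k (k+1) on both sides, so the sum telescopes.

   In expectation <delta, x^k - xs> vanishes and |delta|^2 costs sigma^2,
   because x^k is independent of the k-th sample.  The operator
   norm of F is the square root of lambda_max(F^T F), because a maximiser of
   |F v| on the unit sphere is an eigenvector of F^T F. *)

Require Import Defs.
From HB Require Import structures.
From mathcomp Require Import all_boot all_order all_algebra.
From mathcomp Require Import all_classical all_reals all_analysis.
From mathcomp Require Import measurable_realfun ring lra.
Import Order.TTheory GRing.Theory Num.Theory.
Import numFieldNormedType.Exports.
Set Implicit Arguments.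
Unset Strict Implicit.
Unset Printing Implicit Defensive.
Local Open Scope classical_set_scope.
Local Open Scope ring_scope.

(** * Euclidean geometry *)

Section Euclid.
Variable R : realType.
Implicit Types n : nat.

Lemma dotvC n (u v : 'cV[R]_n) : dotv u v = dotv v u.
Proof. by apply: eq_bigr => i _; rewrite mulrC. Qed.

Lemma dotvDl n (u v w : 'cV[R]_n) : dotv (u + v) w = dotv u w + dotv v w.
Proof.
by rewrite /dotv -big_split; apply: eq_bigr => i _; rewrite !mxE mulrDl.
Qed.

Lemma dotvZl n a (u v : 'cV[R]_n) : dotv (a *: u) v = a * dotv u v.
Proof.
by rewrite /dotv mulr_sumr; apply: eq_bigr => i _; rewrite !mxE mulrA.
Qed.

Lemma dotvNl n (u v : 'cV[R]_n) : dotv (- u) v = - dotv u v.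
Proof. by rewrite -scaleN1r dotvZl mulN1r. Qed.

Lemma dotvDr n (u v w : 'cV[R]_n) : dotv u (v + w) = dotv u v + dotv u w.
Proof. by rewrite dotvC dotvDl !(dotvC u). Qed.

Lemma dotvZr n a (u v : 'cV[R]_n) : dotv u (a *: v) = a * dotv u v.
Proof. by rewrite dotvC dotvZl dotvC. Qed.

Lemma dotvNr n (u v : 'cV[R]_n) : dotv u (- v) = - dotv u v.
Proof. by rewrite dotvC dotvNl dotvC. Qed.

Definition dotvE := (dotvDl, dotvDr, dotvNl, dotvNr, dotvZl, dotvZr).

Lemma dotv0l n (u : 'cV[R]_n) : dotv 0 u = 0.
Proof. by rewrite -(scale0r 0) dotvZl mul0r. Qed.

Lemma dotv_suml n I (r : seq I) (f : I -> 'cV[R]_n) v :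
  dotv (\sum_(i <- r) f i) v = \sum_(i <- r) dotv (f i) v.
Proof.
by elim/big_rec2: _ => [|i a b _ <-]; rewrite ?dotv0l// dotvDl.
Qed.

Lemma dotvv_ge0 n (u : 'cV[R]_n) : 0 <= dotv u u.
Proof. by apply: sumr_ge0 => i _; rewrite -expr2 sqr_ge0. Qed.

Lemma dotvv_eq0 n (u : 'cV[R]_n) : (dotv u u == 0) = (u == 0).
Proof.
apply/eqP/eqP => [|->]; last by rewrite dotv0l.
move/eqP; rewrite psumr_eq0 => [/allP h|i _]; last by rewrite -expr2 sqr_ge0.
apply/matrixP => i j; rewrite !mxE ord1; apply/eqP.
by have /implyP := h i (mem_index_enum i); rewrite -expr2 sqrf_eq0; exact.
Qed.

Lemma sqr_enorm n (u : 'cV[R]_n) : enorm u ^+ 2 = dotv u u.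
Proof. by rewrite sqr_sqrtr ?dotvv_ge0. Qed.

Lemma enorm_ge0 n (u : 'cV[R]_n) : 0 <= enorm u.
Proof. exact: sqrtr_ge0. Qed.

Lemma enormN n (u : 'cV[R]_n) : enorm (- u) = enorm u.
Proof. by rewrite /enorm !dotvE opprK. Qed.

Lemma enormZ n a (u : 'cV[R]_n) : enorm (a *: u) = `|a| * enorm u.
Proof. by rewrite /enorm !dotvE mulrA -expr2 sqrtrM ?sqr_ge0// sqrtr_sqr. Qed.

Lemma ler_enorm n m (u : 'cV[R]_n) (v : 'cV[R]_m) :
  (enorm u <= enorm v) = (dotv u u <= dotv v v).
Proof. by rewrite ler_sqrt ?dotvv_ge0. Qed.

Lemma cauchy_schwarz n (u v : 'cV[R]_n) : dotv u v <= enorm u * enorm v.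
Proof.
have [->|v0] := eqVneq v 0; first by rewrite dotvC dotv0l mulr_ge0 ?enorm_ge0.
have vv : 0 < dotv v v by rewrite lt0r dotvv_eq0 v0 dotvv_ge0.
have := dotvv_ge0 (dotv v v *: u - dotv u v *: v).
rewrite !dotvE (dotvC v u) => h.
have {}h : (dotv u v) ^+ 2 <= dotv u u * dotv v v.
  rewrite -(ler_pM2l vv); nra.
rewrite /enorm -sqrtrM ?dotvv_ge0//.
by apply: le_trans (ler_norm _) _; rewrite -sqrtr_sqr ler_wsqrtr.
Qed.

Lemma coord_le_enorm n (u : 'cV[R]_n) i : `|u i 0| <= enorm u.
Proof.
rewrite -sqrtr_sqr ler_wsqrtr// /dotv (bigD1 i)//= -expr2 lerDl.
by apply: sumr_ge0 => j _; rewrite -expr2 sqr_ge0.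
Qed.

Lemma dotv_mulmx n m (A : 'M[R]_(m, n)) u v :
  dotv u (A *m v) = dotv (A^T *m u) v.
Proof.
rewrite /dotv; under eq_bigr do rewrite mxE mulr_sumr.
rewrite exchange_big; apply: eq_bigr => j _; rewrite mxE mulr_suml.
by apply: eq_bigr => i _; rewrite mxE; ring.
Qed.

Lemma convex_set_comb n (S : set 'cV[R]_n) (u v : 'cV[R]_n) (th : R) :
  convex_set S -> S u -> S v -> 0 <= th <= 1 -> S (th *: u + (1 - th) *: v).
Proof.
move=> cS Su Sv th01.
have := cS u v (Itv01 (proj1 (andP th01)) (proj2 (andP th01))).
by rewrite !inE => /(_ Su Sv).
Qed.

(** Stands in for the limit [th] to 0 in first-variation arguments: if [a] were positive,
    [th = a / (a + b)] would already violate the bound. *)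
Lemma le0_of_le_small (a b : R) : 0 <= b ->
  (forall th, 0 < th <= 1 -> a <= th * b) -> a <= 0.
Proof.
move=> b0 h; rewrite leNgt; apply/negP => a0.
have ab : 0 < a + b by lra.
have /h : 0 < a / (a + b) <= 1.
  by rewrite divr_gt0//= ler_pdivrMr// mul1r; lra.
by rewrite mulrAC ler_pdivlMr//; nra.
Qed.

(** Moving from [p] a fraction [th] towards [q] stays in [S] and cannot reduce the distance to [z].
    Expanding the square and dividing by [th] leaves an error of order [th]. *)
Lemma proj_variational n (S : set 'cV[R]_n) z p q : convex_set S ->
  is_proj S z p -> S q -> dotv (z - p) (q - p) <= 0.
Proof.
move=> cS [Sp pmin] Sq.
apply: (@le0_of_le_small _ (dotv (q - p) (q - p) / 2)).
  by rewrite divr_ge0 ?dotvv_ge0.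
move=> th /andP[th0 th1].
have /pmin : S (th *: q + (1 - th) *: p).
  by apply: (convex_set_comb cS) => //; rewrite (ltW th0).
rewrite ler_enorm (_ : _ + _ - z = th *: (q - p) + (p - z)); last first.
  by apply/matrixP => i j; rewrite !mxE; ring.
rewrite -(opprB p z) dotvNl; move: (q - p) (p - z) => e c.
rewrite !dotvE (dotvC e c) => h.
rewrite -(ler_pM2l th0); lra.
Qed.

Lemma convex_set_sum n (S : set 'cV[R]_n) m (a : nat -> R)
    (u : nat -> 'cV[R]_n) :
  convex_set S -> (forall k, 0 < a k) -> (forall k, S (u k)) ->
  S ((\sum_(k < m.+1) a k)^-1 *: \sum_(k < m.+1) a k *: u k).
Proof.
move=> cS a0 Su; elim: m => [|m IH].
  by rewrite !big_ord1 scalerA mulVf ?scale1r// gt_eqF.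
have s0 : 0 < \sum_(k < m.+1) a k.
  by rewrite big_ord_recl ltr_pwDl// sumr_ge0// => i _; exact: ltW.
rewrite (big_ord_recr _ (fun k => a k)) (big_ord_recr _ (fun k => a k *: u k)) /=.
set A := \sum_(_ < _) _ in IH s0 *; set U := \sum_(_ < _) _ in IH *.
have am := a0 m.+1.
(* The new average is a two-point combination of the old average and the last point; positive
   weights keep [A] invertible. *)
rewrite (_ : (A + _)^-1 *: _ = (A / (A + a m.+1)) *: (A^-1 *: U) +
                                (1 - A / (A + a m.+1)) *: u m.+1).
  apply: (convex_set_comb cS) => //.
  by rewrite divr_ge0/= ?ler_pdivrMr; lra.
rewrite scalerDr !scalerA; congr (_ *: _ + _ *: _); field; lra.
Qed.

(** Finite Jensen inequality with unnormalised weights, by the same two-point splitting as for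
    [convex_set_sum]. *)
Lemma convex_on_sum n (S : set 'cV[R]_n) f m (a : nat -> R)
    (u : nat -> 'cV[R]_n) :
  convex_set S -> convex_on S f -> (forall k, 0 < a k) -> (forall k, S (u k)) ->
  f ((\sum_(k < m.+1) a k)^-1 *: \sum_(k < m.+1) a k *: u k) <=
  (\sum_(k < m.+1) a k)^-1 * \sum_(k < m.+1) a k * f (u k).
Proof.
move=> cS cf a0 Su; elim: m => [|m IH].
  by rewrite !big_ord1 scalerA mulrA mulVf ?scale1r ?mul1r// gt_eqF.
have s0 : 0 < \sum_(k < m.+1) a k.
  by rewrite big_ord_recl ltr_pwDl// sumr_ge0// => i _; exact: ltW.
have SU := @convex_set_sum n S m a u cS a0 Su.
rewrite (big_ord_recr _ (fun k => a k)) (big_ord_recr _ (fun k => a k *: u k)) /=.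
rewrite (big_ord_recr _ (fun k => a k * f (u k))) /=.
set A := \sum_(_ < _) _ in IH s0 SU *; set U := \sum_(_ < _) _ in IH SU *.
set V := \sum_(_ < _) _ in IH *.
have am := a0 m.+1.
rewrite (_ : (A + _)^-1 *: _ = (A / (A + a m.+1)) *: (A^-1 *: U) +
                                (1 - A / (A + a m.+1)) *: u m.+1); last first.
  by rewrite scalerDr !scalerA; congr (_ *: _ + _ *: _); field; lra.
have th01 : 0 <= A / (A + a m.+1) <= 1 by rewrite divr_ge0/= ?ler_pdivrMr; lra.
apply: (le_trans (cf _ _ SU (Su m.+1) _ th01)).
have := ler_wpM2l (proj1 (andP th01)) IH.
set Z := f _ => h.
apply: (@le_trans _ _ (A / (A + a m.+1) * (A^-1 * V) +
                       (1 - A / (A + a m.+1)) * f (u m.+1))).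
  by rewrite lerD2r.
by rewrite le_eqVlt; apply/orP; left; apply/eqP; field; lra.
Qed.

Lemma strongly_convex_first_order n (S : set 'cV[R]_n) f gradf (mu : R) u v :
  0 <= mu -> strongly_convex_on S f gradf mu -> S u -> S v ->
  dotv (v - u) (gradf u) <= f v - f u.
Proof.
move=> mu0 sc Su Sv; have := sc _ _ Su Sv.
have : 0 <= mu / 2 * enorm (v - u) ^+ 2 by rewrite mulr_ge0 ?sqr_ge0 ?divr_ge0.
lra.
Qed.

(* Summing the first-order inequality at the [N] subdivision points of the
   segment [u, v] gives the bound with constant [L / 2 * (1 + 1 / N)]. *)
Lemma descent_lemma n (S : set 'cV[R]_n) f gradf (mu L : R) u v :
  convex_set S -> 0 <= mu -> strongly_convex_on S f gradf mu -> 0 <= L ->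
  (forall x1 x2, S x1 -> S x2 ->
     enorm (gradf x1 - gradf x2) <= L * enorm (x1 - x2)) ->
  S u -> S v ->
  f v <= f u + dotv (gradf u) (v - u) + L / 2 * enorm (v - u) ^+ 2.
Proof.
move=> cS mu0 sc L0 lip Su Sv.
set h := v - u; set G := dotv _ h; set H := enorm h ^+ 2.
have H0 : 0 <= H by rewrite sqr_ge0.
suff key N : (0 < N)%N -> f v - f u - G <= L / 2 * H * (1 + N%:R^-1).
  rewrite -subr_ge0 -oppr_le0 opprB.
  apply/ler_addgt0Pr => e e0; rewrite add0r.
  (* This many subdivisions push the excess [L / 2 * H / N] below [e]. *)
  pose N := (Num.truncn (L / 2 * H / e)).+1.
  have := key N isT; have : L / 2 * H / e < N%:R by exact: truncnS_gt.
  have N0 : 0 < N%:R :> R by [].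
  rewrite ltr_pdivrMr// => h1 h2.
  have : L / 2 * H * N%:R^-1 <= e by rewrite ler_pdivrMr// mulrC ltW// mulrC; lra.
  by move: h2; rewrite mulrDr mulr1; lra.
move=> N0; have N0' : 0 < N%:R :> R by rewrite ltr0n.
pose p i : 'cV[R]_n := u + (i%:R / N%:R) *: h.
have Sp i : (i <= N)%N -> S (p i).
  move=> iN; rewrite (_ : p i = (i%:R / N%:R) *: v + (1 - i%:R / N%:R) *: u).
    apply: (convex_set_comb cS) => //.
    by rewrite divr_ge0//= ler_pdivrMr// mul1r ler_nat.
  by rewrite /p /h; apply/matrixP => a b; rewrite !mxE; ring.
(* The first-order inequality is taken at the right endpoint [p i.+1], which bounds the increment
   from above; the Lipschitz bound then replaces that gradient by the one at [u]. *)
have step i : (i < N)%N ->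
    f (p i.+1) - f (p i) <= N%:R^-1 * G + L * H / N%:R ^+ 2 * i.+1%:R.
  move=> iN; have := strongly_convex_first_order mu0 sc (Sp _ iN) (Sp _ (ltnW iN)).
  have -> : p i - p i.+1 = - (N%:R^-1 *: h).
    by rewrite /p; apply/matrixP => a b; rewrite !mxE -natr1; field; lra.
  rewrite dotvNl dotvZl => h1.
  have h2 : dotv h (gradf (p i.+1)) <= G + L * H / N%:R * i.+1%:R.
    have := cauchy_schwarz (gradf (p i.+1) - gradf u) h.
    have := ler_wpM2r (enorm_ge0 h) (lip _ _ (Sp _ iN) Su).
    rewrite (_ : p i.+1 - u = (i.+1%:R / N%:R) *: h); last first.
      by rewrite /p addrC addKr.
    rewrite enormZ ger0_norm ?divr_ge0// dotvDl dotvNl -/G (dotvC (gradf _) h).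
    rewrite (_ : L * (_ * enorm h) * _ = L * H / N%:R * i.+1%:R); last first.
      by rewrite /H; ring.
    lra.
  have Ni : 0 <= N%:R^-1 :> R by rewrite invr_ge0 ltW.
  have := ler_wpM2l Ni h2.
  rewrite (_ : N%:R^-1 * (_ + _) = N%:R^-1 * G + L * H / N%:R ^+ 2 * i.+1%:R).
    by lra.
  by field; lra.
have tel m : (m <= N)%N -> f (p m) - f (p 0%N) <=
    m%:R * (N%:R^-1 * G) + L * H / N%:R ^+ 2 * (m%:R * m.+1%:R / 2).
  elim: m => [_|m IH mN]; first by rewrite subrr !mul0r mulr0 addr0.
  have := IH (ltnW mN); have := step _ mN.
  set q := L * H / _; set b := N%:R^-1 * G.
  rewrite -(natr1 m.+1) -(natr1 m) => h1 h2.
  have := lerD h1 h2; rewrite (addrC (f (p m.+1) - _)) addrC subrKA => h3.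
  by apply: (le_trans h3); rewrite le_eqVlt; apply/orP; left; apply/eqP; field.
have := tel N (leqnn N).
have -> : p N = v by rewrite /p divff ?gt_eqF// scale1r /h addrC subrK.
have -> : p 0%N = u by rewrite /p mul0r scale0r addr0.
rewrite mulrA mulfV ?gt_eqF// mul1r.
rewrite (_ : L * H / _ * _ = L / 2 * H * (1 + N%:R^-1)); first by lra.
by rewrite -natr1; field; lra.
Qed.

End Euclid.

(** * Projections and measurability *)

Section Topology.
Variable R : realType.
Implicit Types n : nat.

Lemma dotv_continuous n (T : topologicalType) (f g : T -> 'cV[R]_n) :
  (forall i, continuous (fun x => f x i 0)) ->
  (forall i, continuous (fun x => g x i 0)) ->
  continuous (fun x => dotv (f x) (g x)).
Proof.
move=> cf cg; apply: (@continuous_big _ _ +%R 0 xpredT add_continuous) => i _ x.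
by apply: cvgM; [exact: cf|exact: cg].
Qed.

Lemma enormB_continuous n (v : 'cV[R]_n) :
  continuous (fun u : 'cV[R]_n => enorm (u - v)).
Proof.
have c i : continuous (fun u : 'cV[R]_n => (u - v) i 0).
  rewrite (_ : (fun u => _) = (fun u : 'cV[R]_n => u i 0) \- cst (v i 0)).
    by move=> u; apply: continuousB; [exact: coord_continuous|exact: cst_continuous].
  by apply/funext => u; rewrite !mxE.
move=> u; apply: (@continuous_comp _ _ _
  (fun u : 'cV[R]_n => dotv (u - v) (u - v)) Num.sqrt).
  exact: dotv_continuous.
exact: sqrt_continuous.
Qed.

Lemma lipschitz_enorm_continuous n (f : 'cV[R]_n -> R) K :
  (forall u v, `|f u - f v| <= K * enorm (u - v)) -> continuous f.
Proof.
move=> lf v; have FF := @nbhs_filter 'cV[R]_n v.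
apply/(@cvgrPdist_le _ _ _ (nbhs v) FF) => e e0.
have : (fun u => K * enorm (u - v)) u @[u --> v] --> (K * enorm (v - v) : R).
  by apply: (@cvgMl_tmp _ _ (nbhs v) FF); exact: enormB_continuous.
rewrite subrr /enorm dotv0l sqrtr0 mulr0.
move=> /(@cvgrPdist_le _ _ _ (nbhs v) FF) /(_ _ e0); apply: filterS => u.
rewrite sub0r normrN => h; rewrite distrC (le_trans (lf _ _))//.
exact: le_trans (ler_norm _) h.
Qed.

(** Links the topology of column vectors to the product sigma-algebra of tuples: an open set is the
    countable union of the rational boxes it contains. *)
Lemma measurable_open_cv n (U : set 'cV[R]_n) : open U ->
  measurable ((@cv_of_tuple R n) @^-1` U).
Proof.
move=> oU.
pose box (q : 'cV[rat]_n) (r : rat) : set (n.-tuple R) :=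
  \bigcap_(i in [set: 'I_n]) [set t | `|ratr (q i 0) - tnth t i| < ratr r].
have mbox q r : measurable (box q r).
  apply: fin_bigcap_measurable => // i _.
  have -> : [set t : n.-tuple R | `|ratr (q i 0) - tnth t i| < ratr r] =
    (@tnth n R ^~ i) @^-1` (ball (ratr (q i 0) : R) (ratr r)).
    by apply/seteqP; split=> t.
  rewrite -[X in measurable X]setTI; apply: measurable_tnth => //.
  exact: measurable_ball.
have ballE (v w : 'cV[R]_n) e : 0 < e ->
    ball v e w <-> forall i, `|v i 0 - w i 0| < e.
  move=> e0; split=> [[_ h] i|h]; first exact: h.
  by split=> // i j; rewrite ord1; exact: h.
have -> : (@cv_of_tuple R n) @^-1` U =
  \bigcup_(qr : 'cV[rat]_n * rat)
    (if `[< box qr.1 qr.2 `<=` (@cv_of_tuple R n) @^-1` U >]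
     then box qr.1 qr.2 else set0).
  apply/seteqP; split=> [t Ut|t [qr _]]; last first.
    by case: ifPn => // /asboolP h /h.
  have : nbhs (cv_of_tuple t) U by exact: open_nbhs_nbhs.
  move=> /nbhs_ballP[e /= e0 he].
  (* Two points of a box of radius [r < e / 2] differ by less than [e] in each coordinate, so the
     box around [t] stays in the ball. *)
  have [r] := @rat_in_itvoo R 0 (e / 2) ltac:(lra).
  rewrite in_itv/= => /andP[r0 re].
  have hq i : exists q : rat, `|ratr q - tnth t i| < ratr r.
    have [q] := @rat_in_itvoo R (tnth t i - ratr r) (tnth t i + ratr r) ltac:(lra).
    by rewrite in_itv/= => /andP[h1 h2]; exists q; rewrite ltr_norml; lra.
  pose q : 'cV[rat]_n := \col_i projT1 (cid (hq i)).
  have qP i : `|ratr (q i 0) - tnth t i| < ratr r.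
    by rewrite mxE; exact: projT2 (cid (hq i)).
  exists (q, r) => //; rewrite /= asboolT; first by move=> i _; exact: qP.
  move=> t' bt'; apply: he; apply/ballE => // i; rewrite !mxE.
  have := bt' i I; have := qP i; rewrite /= !ltr_norml; lra.
apply: countable_bigcupT_measurable; first exact: countableP.
by move=> qr; case: ifP.
Qed.

Lemma measurable_continuous_cv n (f : 'cV[R]_n -> R) : continuous f ->
  measurable_fun setT (f \o @cv_of_tuple R n).
Proof.
move=> /continuousP cf.
apply: (measurability _ (RGenOInfty.measurableE R)) => //.
move=> _ [_ [a ->] <-]; rewrite setTI comp_preimage.
by apply: measurable_open_cv; apply: cf; exact: interval_open.
Qed.

Definition tuple_of_cv n (v : 'cV[R]_n) : n.-tuple R := [tuple v i 0 | i < n].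

Lemma tuple_of_cvK n : cancel (@tuple_of_cv n) (@cv_of_tuple R n).
Proof. by move=> v; apply/matrixP => i j; rewrite !mxE tnth_mktuple ord1. Qed.

Lemma measurable_tuple_of_cv d (T : measurableType d) n (f : T -> 'cV[R]_n) :
  (forall i, measurable_fun setT (fun x => f x i 0)) ->
  measurable_fun setT (fun x => tuple_of_cv (f x)).
Proof.
move=> mf; apply/measurable_fun_tnthP => i.
by apply: eq_measurable_fun (mf i) => x _ /=; rewrite tnth_mktuple.
Qed.

Lemma measurable_comp_cv d (T : measurableType d) n (f : T -> 'cV[R]_n)
    (h : 'cV[R]_n -> R) :
  continuous h -> (forall i, measurable_fun setT (fun x => f x i 0)) ->
  measurable_fun setT (fun x => h (f x)).
Proof.
move=> ch mf.
have := measurableT_comp (measurable_continuous_cv ch)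
  (measurable_tuple_of_cv mf).
by apply: eq_measurable_fun => x _ /=; rewrite tuple_of_cvK.
Qed.

(** Turns the projection relation into a function. The default 0 is never reached when [S] is
    nonempty and compact. *)
Definition eproj n (S : set 'cV[R]_n) (z : 'cV[R]_n) : 'cV[R]_n :=
  xget 0 [set p | is_proj S z p].

Lemma eprojP n (S : set 'cV[R]_n) z : S !=set0 -> compact S ->
  is_proj S z (eproj S z).
Proof.
move=> S0 cS; rewrite /eproj; case: xgetP => [//|/= none].
have [|p] := @compact_EVT_min _ _ (fun q : 'cV[R]_n => enorm (q - z)) S S0 cS.
  exact/continuous_subspaceT/enormB_continuous.
rewrite inE => Sp pmin; case: (none p); split=> // q Sq.
by apply: pmin; rewrite inE.
Qed.

(** Add the two variational inequalities, each tested at the other projection, apply Cauchy-Schwarz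
    and cancel one factor [enorm (p1 - p2)]. *)
Lemma proj_nonexpansive n (S : set 'cV[R]_n) z1 z2 p1 p2 : convex_set S ->
  is_proj S z1 p1 -> is_proj S z2 p2 -> enorm (p1 - p2) <= enorm (z1 - z2).
Proof.
move=> cS h1 h2.
have v1 := proj_variational cS h1 h2.1.
have v2 := proj_variational cS h2 h1.1.
have h : dotv (p1 - p2) (p1 - p2) <= dotv (z1 - z2) (p1 - p2).
  by move: v1 v2; rewrite !dotvE (dotvC p2 p1); lra.
have := le_trans h (cauchy_schwarz _ _); rewrite -sqr_enorm expr2.
have [->|n0] := eqVneq (enorm (p1 - p2)) 0; first by rewrite enorm_ge0.
by rewrite ler_pM2r// lt0r n0 enorm_ge0.
Qed.

Lemma is_proj_eq n (S : set 'cV[R]_n) z p : convex_set S ->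
  S !=set0 -> compact S -> is_proj S z p -> p = eproj S z.
Proof.
move=> cS S0 kS hp; have := proj_nonexpansive cS hp (eprojP z S0 kS).
rewrite subrr /enorm dotv0l sqrtr0 => h.
have /eqP : Num.sqrt (dotv (p - eproj S z) (p - eproj S z)) == 0.
  by rewrite eq_le h sqrtr_ge0.
move/eqP; rewrite sqrtr_eq0 => h'.
by apply/eqP; rewrite -subr_eq0 -dotvv_eq0 eq_le h' dotvv_ge0.
Qed.

(** Extends a function controlled only on [S] to a globally Lipschitz one, since the projection is
    nonexpansive; continuity then gives measurability. *)
Lemma lipschitz_proj_continuous n (S : set 'cV[R]_n) (f : 'cV[R]_n -> R) K :
  convex_set S -> S !=set0 -> compact S -> 0 <= K ->
  (forall u v, S u -> S v -> `|f u - f v| <= K * enorm (u - v)) ->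
  continuous (fun z => f (eproj S z)).
Proof.
move=> cS S0 kS K0 lf; apply: (@lipschitz_enorm_continuous n _ K) => u v.
have hu := eprojP u S0 kS; have hv := eprojP v S0 kS.
apply: (le_trans (lf _ _ hu.1 hv.1)).
by rewrite ler_wpM2l// (proj_nonexpansive cS hu hv).
Qed.

Lemma proj_coord_continuous n (S : set 'cV[R]_n) i : convex_set S ->
  S !=set0 -> compact S -> continuous (fun z => eproj S z i 0).
Proof.
move=> cS S0 kS.
apply: (@lipschitz_proj_continuous n S (fun z => z i 0) 1) => // u v _ _.
by rewrite mul1r -[X in enorm X]/(u - v) (le_trans _ (coord_le_enorm _ i))// !mxE.
Qed.

Lemma enorm_le_diam n (S : set 'cV[R]_n) u v : compact S -> S u -> S v ->
  enorm (u - v) <= diam S.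
Proof.
move=> kS Su Sv; apply: ub_le_sup; last by exists u, v.
have [p _ pmax] := @compact_EVT_max _ _ (fun q : 'cV[R]_n => enorm (q - 0)) S
  (ex_intro S u Su) kS
  (continuous_subspaceT (@enormB_continuous n 0)).
(* The supremum defining [diam] is meaningful only for a bounded set; twice the largest norm on [S]
   is a bound. *)
exists (2 * enorm p) => _ [a [b [Sa Sb ->]]].
have := pmax a (mem_set Sa); have := pmax b (mem_set Sb); rewrite !subr0 => hb ha.
rewrite -(@ler_pXn2r _ 2) ?nnegrE ?mulr_ge0 ?enorm_ge0//.
have := cauchy_schwarz a (- b).
rewrite sqr_enorm enormN !dotvE (dotvC b a) -!sqr_enorm.
have := enorm_ge0 a; have := enorm_ge0 b; nra.
Qed.

End Topology.

(** * The largest eigenvalue of a Gram matrix *)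

Section LambdaMax.
Variable R : realType.

(** Closed, and bounded because coordinates are dominated by the Euclidean norm. Row vectors match
    the eigenvectors of [eigenvalueP]. *)
Lemma unit_sphere_compact n : compact [set v : 'rV[R]_n | dotv v^T v^T = 1].
Proof.
apply: bounded_closed_compact.
  exists 1; split=> // M M1 v /= v1.
  apply: (@le_trans _ _ 1); last exact: ltW.
  rewrite [leLHS]/Num.norm/= mx_normrE; apply/bigmax_leP; split=> // -[i j] _ /=.
  have := coord_le_enorm v^T j; rewrite mxE (ord1 i) => /le_trans; apply.
  by rewrite /enorm v1 sqrtr1.
rewrite (_ : [set _ | _] = (fun v : 'rV[R]_n => dotv v^T v^T) @^-1` [set 1])//.
apply: preimage_closed; last exact: closed_eq.
have c i : continuous (fun v : 'rV[R]_n => v^T i 0).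
  rewrite (_ : (fun v => _) = (fun v : 'rV[R]_n => v 0 i)).
    exact: coord_continuous.
  by apply/funext => v; rewrite mxE.
by move=> v _; apply: (dotv_continuous c c).
Qed.

(* A maximiser [v] of [|A v|^2] on the unit sphere has
   [|A v|^2 |w|^2 - |A w|^2 >= 0] for all [w]; expanding at [w = v + e u] shows
   that [v] is an eigenvector. *)
Lemma gram_top_eigenvector m n (A : 'M[R]_(m, n)) : (0 < n)%N ->
  exists a, [/\ 0 <= a, eigenvalue (A^T *m A) a &
    forall w, dotv (A *m w) (A *m w) <= a * dotv w w].
Proof.
move=> n0.
pose q (w : 'cV[R]_n) := dotv (A *m w) (A *m w).
have S0 : [set v : 'rV[R]_n | dotv v^T v^T = 1] !=set0.
  exists (delta_mx 0 (Ordinal n0)) => /=.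
  rewrite /dotv (bigD1 (Ordinal n0))//= !mxE !eqxx mulr1 big1 ?addr0// => i ni.
  by rewrite !mxE eqxx/= (negbTE ni) mulr0.
have cq : continuous (fun v : 'rV[R]_n => q v^T).
  have c i : continuous (fun v : 'rV[R]_n => (A *m v^T) i 0).
    rewrite (_ : (fun v => _) = (fun v : 'rV[R]_n => \sum_j A i j * v 0 j)).
      apply: (@continuous_big _ _ +%R 0 xpredT add_continuous) => j _ x.
      apply: continuousM; first exact: cst_continuous.
      exact: coord_continuous.
    by apply/funext => v; rewrite mxE; apply: eq_bigr => j _; rewrite mxE.
  exact: (dotv_continuous c c).
have [v] := compact_EVT_max S0 (@unit_sphere_compact n) (continuous_subspaceT cq).
rewrite inE/= => v1 vmax; set a := q v^T.
have a0 : 0 <= a by exact: dotvv_ge0.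
have qmax w : q w <= a * dotv w w.
  have [->|w0] := eqVneq w 0.
    by rewrite /q mulmx0 !dotv0l mulr0.
  have ww : 0 < dotv w w by rewrite lt0r dotvv_eq0 w0 dotvv_ge0.
  have nw : 0 < enorm w by rewrite sqrtr_gt0.
  have := vmax ((enorm w)^-1 *: w)^T.
  rewrite inE/= !trmxK !dotvE.
  have e2 : (enorm w)^-1 * ((enorm w)^-1 * dotv w w) = 1.
    by rewrite -sqr_enorm; field; rewrite gt_eqF.
  move=> /(_ e2); rewrite /q -scalemxAr !dotvE -/(q w) -/a => h.
  have := ler_wpM2r (ltW ww) h; rewrite -{1}sqr_enorm.
  by rewrite (_ : _ * _ * _ = q w)//; field; rewrite gt_eqF.
exists a; split=> //.
apply/eigenvalueP; exists v; last first.
  apply/eqP => v0; move: v1; rewrite v0 trmx0 dotv0l => /eqP.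
  by rewrite eq_sym oner_eq0.
(* The residual of the eigenvector equation serves as its own direction of perturbation: the
   first-order term is then [2 * th * dotv e e], which forces [e = 0]. *)
have [e eE] : exists e, e = A^T *m (A *m v^T) - a *: v^T by eexists.
suff e0 : e = 0.
  move/esym/eqP: eE; rewrite e0 subr_eq0 => /eqP/(congr1 trmx).
  by rewrite !trmx_mul !trmxK linearZ/= trmxK -mulmxA.
apply/eqP; rewrite -dotvv_eq0 eq_le dotvv_ge0 andbT.
apply: (@le0_of_le_small _ _ (a * dotv e e / 2)).
  by rewrite divr_ge0// mulr_ge0// dotvv_ge0.
move=> th /andP[th0 _].
have := qmax (v^T + th *: e).
rewrite /q mulmxDr -scalemxAr !dotvE -/(q v^T) v1 -/a.
rewrite (dotvC (A *m e) (A *m v^T)) (dotvC e v^T) => h.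
have ee : dotv e e = dotv (A *m v^T) (A *m e) - a * dotv v^T e.
  by rewrite {1}eE dotvDl dotvNl dotvZl -dotv_mulmx.
have := dotvv_ge0 (A *m e).
rewrite -(ler_pM2l th0); nra.
Qed.

Lemma lambda_max_gram m n (A : 'M[R]_(m, n)) : 0 <= lambda_max (A^T *m A) /\
  forall w, dotv (A *m w) (A *m w) <= lambda_max (A^T *m A) * dotv w w.
Proof.
case: n => [|n] in A *.
  (* In dimension 0 there is no eigenvector, and the supremum of the empty set is 0. *)
  have -> : lambda_max (A^T *m A) = 0.
    rewrite /lambda_max (_ : [set _ | _] = set0) ?sup0//.
    apply/seteqP; split=> // a /= /eigenvalueP[v _] /eqP; apply.
    by apply/matrixP => i [].
  split=> // w; rewrite (_ : w = 0) ?mulmx0 ?dotv0l ?mulr0//.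
  by apply/matrixP => -[].
have [a [a0 ea amax]] := gram_top_eigenvector A isT.
have aL : a <= lambda_max (A^T *m A).
  (* The set of eigenvalues is bounded by [a] itself: an eigenvector [v] for [b] satisfies
     [b |v|^2 = |A v|^2 <= a |v|^2]. *)
  apply: ub_le_sup => //; exists a => b /= /eigenvalueP[v vb v0].
  have vv : 0 < dotv v^T v^T.
    by rewrite lt0r dotvv_ge0 dotvv_eq0 andbT -trmx0 (inj_eq trmx_inj).
  rewrite -(ler_pM2r vv) -dotvZl -linearZ/= -vb !trmx_mul trmxK -mulmxA.
  by rewrite dotvC dotv_mulmx trmxK.
split; first exact: le_trans aL.
by move=> w; apply: le_trans (amax w) _; rewrite ler_wpM2r ?dotvv_ge0.
Qed.

End LambdaMax.

(** * Chains driven by independent samples *)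

Section Integral.
Local Open Scope ereal_scope.

Import HBNNSimple.

(* The integral of a nonnegative function is the supremum of the integrals of
   the simple functions below it, whether or not it is measurable. *)
Lemma ge0_le_integralT d (T : measurableType d) (R : realType)
    (m : {measure set T -> \bar R}) (f1 f2 : T -> \bar R) :
  (forall x, 0 <= f1 x) -> (forall x, f1 x <= f2 x) ->
  \int[m]_x f1 x <= \int[m]_x f2 x.
Proof.
move=> f10 f12; rewrite !ge0_integralTE//; last first.
  by move=> x; exact: le_trans (f12 x).
apply: ereal_sup_le => _ [h hf <-]; exists h => // x.
exact: le_trans (f12 x).
Qed.

Lemma pushforward_measure d1 d2 (T1 : measurableType d1)
    (T2 : measurableType d2) (R : realType)
    (m : {measure set T1 -> \bar R}) (f : T1 -> T2) :
  measurable_fun setT f -> exists m' : {measure set T2 -> \bar R},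
    (m' : set T2 -> \bar R) = pushforward m f.
Proof.
by move=> mf; unshelve eexists (pushforward m f : {measure set T2 -> \bar R}).
Qed.

(** Measurable rectangles are stable under intersection, contain the whole space and generate the
    product sigma-algebra, so they determine a finite measure. *)
Lemma eq_measure_rectangles d1 d2 (T1 : measurableType d1)
    (T2 : measurableType d2) (R : realType)
    (m1 m2 : {measure set (T1 * T2) -> \bar R}) :
  m1 setT < +oo ->
  (forall A B, measurable A -> measurable B -> m1 (A `*` B) = m2 (A `*` B)) ->
  forall C, measurable C -> m1 C = m2 C.
Proof.
move=> fin m12 C mC.
apply: (measure_unique [set A `*` B | A in measurable & B in measurable]
  (fun=> setT)) => //.
- exact: measurable_prod_measurableType.
- move=> _ _ [A1 mA1 [B1 mB1 <-]] [A2 mA2 [B2 mB2 <-]].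
  by rewrite -setXI; exists (A1 `&` A2); [exact: measurableI|
    exists (B1 `&` B2) => //; exact: measurableI].
- by move=> _; exists setT => //; exists setT => //; rewrite setXTT.
- by rewrite bigcup_const.
- by move=> _ [A mA [B mB <-]]; exact: m12.
Qed.

End Integral.

Section Chain.
Local Open Scope ereal_scope.
Variables (R : realType) (dO dX dT : measure_display).
Variables (Omega : measurableType dO) (Xi : measurableType dX).
Variables (T : measurableType dT) (P : probability Omega R).
Variables (PXi : probability Xi R) (xi : nat -> Omega -> Xi).
Hypothesis mxi : forall k, measurable_fun setT (xi k).
Hypothesis law_xi :
  forall k (A : set Xi), measurable A -> P (xi k @^-1` A) = PXi A.
Hypothesis ind : mutually_independent P xi.
Variables (S : nat -> Omega -> T) (Phi : nat -> T * Xi -> T) (s0 : T).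
Hypothesis mPhi : forall k, measurable_fun setT (Phi k).
Hypothesis S0 : forall w, S 0%N w = s0.
Hypothesis Snext : forall k w, S k.+1 w = Phi k (S k w, xi k w).

Lemma chain_measurable k : measurable_fun setT (S k).
Proof.
elim: k => [|k IH].
  by apply: eq_measurable_fun (measurable_cst s0) => w _; rewrite S0.
apply: (eq_measurable_fun (Phi k \o (fun w => (S k w, xi k w)))).
  by move=> w _ /=; rewrite Snext.
by apply: measurableT_comp (mPhi k) _; exact: measurable_fun_pair.
Qed.

Let Z k w := (S k w, xi k w).

Let mZ k : measurable_fun setT (Z k).
Proof. by apply: measurable_fun_pair => //; exact: chain_measurable. Qed.

Let cyl (s : seq nat) (B : nat -> set Xi) :=
  \bigcap_(j in [set j | j \in s]) (xi j @^-1` B j).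

Let mpre d' (T' : measurableType d') (f : Omega -> T') A :
  measurable_fun setT f -> measurable A -> measurable (f @^-1` A).
Proof. by move=> mf mA; rewrite -[X in measurable X]setTI; exact: mf. Qed.

Let mcyl s B : (forall j, measurable (B j)) -> measurable (cyl s B).
Proof.
move=> mB; apply: fin_bigcap_measurable => [|j _]; last exact: mpre.
exact: finite_seq.
Qed.

Let cyl_cons k s B : cyl (k :: s) B = xi k @^-1` B k `&` cyl s B.
Proof.
apply/seteqP; split=> w.
  by move=> h; split; [apply: h; rewrite /= mem_head|
    move=> j js; apply: h; rewrite /= inE js orbT].
by move=> [hk h] j; rewrite /= inE => /orP[/eqP->//|]; exact: h.
Qed.

Let Pcyl_cons k s B : (forall j, measurable (B j)) -> uniq (k :: s) ->
  P (cyl (k :: s) B) = PXi (B k) * P (cyl s B).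
Proof.
move=> mB us; rewrite /cyl !ind//; last by case/andP: us.
by rewrite big_cons law_xi.
Qed.

(** [S k] is built from the samples of index below [k]. Allowing any finite list of later samples is
    what makes the induction close. *)
Lemma chain_indep_future k A s B : measurable A ->
  (forall j, measurable (B j)) -> uniq s -> all (leq k) s ->
  P (S k @^-1` A `&` cyl s B) = P (S k @^-1` A) * P (cyl s B).
Proof.
elim: k A s B => [|k IH] A s B mA mB us ks.
  have [As0|As0] := pselect (A s0).
    rewrite (_ : S 0 @^-1` A = setT) ?setTI ?probability_setT ?mul1e//.
    by apply/seteqP; split=> // w _; rewrite /= S0.
  rewrite (_ : S 0 @^-1` A = set0) ?set0I ?measure0 ?mul0e//.
  by apply/seteqP; split=> // w; rewrite /= S0.
have mE := mcyl s mB.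
have PEfin : P (cyl s B) \is a fin_num by exact: fin_num_measure.
pose c : {nonneg R} := NngNum (fine_ge0 (measure_ge0 P (cyl s B))).
have cE : c%:num%:E = P (cyl s B) by rewrite /= fineK.
(* [m1] is the law of [(S k, xi k)] restricted to the future cylinder, [m2] the full law scaled by
   its probability. Agreement on rectangles extends to the preimage of [A] under [Phi k], an event
   about [S k.+1]. *)
have [m1 m1P] := pushforward_measure (mrestr P mE) (mZ k).
have [m0 m0P] := pushforward_measure P (mZ k).
pose m2 : {measure set (T * Xi) -> \bar R} := mscale c m0.
have m1E C : m1 C = P (Z k @^-1` C `&` cyl s B) by rewrite m1P.
have m2E C : m2 C = P (cyl s B) * P (Z k @^-1` C).
  by rewrite /m2/= /mscale cE m0P.
have kNs : k \notin s.
  by apply/negP => kIs; have := allP ks _ kIs; rewrite ltnn.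
have rect A' B' : measurable A' -> measurable B' ->
    m1 (A' `*` B') = m2 (A' `*` B').
  move=> mA' mB'.
  (* Merges the constraint on [xi k] into the cylinder, so that the induction hypothesis applies to
     [k :: s] and to [[:: k]]. *)
  pose B1 j := if j == k then B' else B j.
  have mB1 j : measurable (B1 j) by rewrite /B1; case: ifP.
  have cylB1 : cyl s B1 = cyl s B.
    apply: eq_bigcapr => j /= js; rewrite /B1 ifN//.
    by apply: contraNneq kNs => <-.
  have ks' : all (leq k) s by apply: sub_all ks => j; exact: ltnW.
  have ZE : Z k @^-1` (A' `*` B') = S k @^-1` A' `&` xi k @^-1` B1 k.
    by rewrite /B1 eqxx.
  have u1 : uniq (k :: s) by rewrite /= kNs.
  have e0 : cyl [::] B1 = setT by apply/seteqP; split.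
  rewrite m1E m2E ZE -setIA -cylB1 -cyl_cons.
  rewrite IH//=; last by rewrite leqnn.
  rewrite Pcyl_cons//.
  have -> : xi k @^-1` B1 k = cyl [:: k] B1 by rewrite cyl_cons e0 setIT.
  rewrite IH//=; last by rewrite leqnn.
  rewrite Pcyl_cons// e0 probability_setT mule1.
  by rewrite muleA [RHS]muleC.
have m1fin : m1 setT < +oo.
  by rewrite m1E preimage_setT setTI ltey_eq PEfin.
have mC : measurable (Phi k @^-1` A).
  by rewrite -[X in measurable X]setTI; exact: mPhi.
have := eq_measure_rectangles m1fin rect mC.
rewrite m1E m2E muleC.
rewrite (_ : Z k @^-1` (Phi k @^-1` A) = S k.+1 @^-1` A)//.
by apply/seteqP; split=> w; rewrite /= Snext.
Qed.

Let Sf k : {mfun Omega >-> T} :=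
  HB.pack (S k) (isMeasurableFun.Build _ _ _ _ _ (chain_measurable k)).

Let joint k : {measure set (T * Xi) -> \bar R} := distribution P (Sf k) \x PXi.

Let joint_law k C : measurable C -> P (Z k @^-1` C) = joint k C.
Proof.
move=> mC.
have [m mP] := pushforward_measure P (mZ k).
have mE D : m D = P (Z k @^-1` D) by rewrite mP.
rewrite -mE; apply: eq_measure_rectangles => //.
  by rewrite mE preimage_setT probability_setT ltry.
move=> A B mA mB; rewrite mE /joint/= product_measure1E//=.
rewrite /distribution /pushforward/=.
have := @chain_indep_future k A [:: k] (fun=> B) mA (fun=> mB) isT.
rewrite /= leqnn => /(_ isT).
have e0 : cyl [::] (fun=> B) = setT by apply/seteqP; split.
by rewrite Pcyl_cons// cyl_cons e0 setIT probability_setT mule1 => <-.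
Qed.

Let integral_joint k (f : T * Xi -> \bar R) : measurable_fun setT f ->
  (forall p, 0 <= f p) -> \int[P]_w f (Z k w) = \int[joint k]_p f p.
Proof.
move=> mf f0.
rewrite -(@ge0_integral_pushforward _ _ _ _ _ (Z k) (mZ k) P setT f)//.
have [m mE] := pushforward_measure P (mZ k).
rewrite -mE; apply: eq_measure_integral => C mC _.
by rewrite mE -joint_law.
Qed.

(** Conditioning on the state: the joint law of [(S k, xi k)] is a product, so the fresh sample can
    be averaged first with the state frozen. *)
Lemma chain_fubini_ge0 k (f : T * Xi -> \bar R) : measurable_fun setT f ->
  (forall p, 0 <= f p) ->
  \int[P]_w f (S k w, xi k w) = \int[P]_w \int[PXi]_z f (S k w, z).
Proof.
move=> mf f0; rewrite (integral_joint k mf f0) /joint fubini_tonelli1//.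
rewrite (@ge0_integral_pushforward _ _ _ _ _ (Sf k) (chain_measurable k) P setT)//.
  exact: measurable_fun_fubini_tonelli_F.
by move=> v _; apply: integral_ge0 => z _.
Qed.

Lemma chain_fubini k (f : T * Xi -> \bar R) : measurable_fun setT f ->
  P.-integrable setT (fun w => f (S k w, xi k w)) ->
  \int[P]_w f (S k w, xi k w) = \int[P]_w \int[PXi]_z f (S k w, z).
Proof.
move=> mf fint.
(* Integrability passes to the product law by the nonnegative change of variables applied to
   [|f|]. *)
have jf : (joint k).-integrable setT f.
  apply/integrableP; split=> //.
  rewrite -(@integral_joint k (fun p => `|f p|))//; last exact: measurableT_comp.
  by case/integrableP: fint.
have [m mE] := pushforward_measure P (mZ k).
transitivity (\int[joint k]_p f p).
  rewrite -(@integral_pushforward _ _ _ _ _ (Z k) (mZ k) P setT f)//.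
  by rewrite -mE; apply: eq_measure_integral => C mC _; rewrite mE -joint_law.
rewrite /joint -integral12_prod_meas1//.
rewrite (@integral_pushforward _ _ _ _ _ (Sf k) (chain_measurable k) P setT)//.
  exact: measurable_fubini_F jf.
have /integrableP[mF Foo] := integrable_fubini_F jf.
rewrite preimage_setT; apply/integrableP; split.
  exact: measurableT_comp mF (chain_measurable k).
apply: le_lt_trans Foo; rewrite ge0_integral_pushforward//.
exact: measurableT_comp.
Qed.

End Chain.

(** * The one-step inequality *)

Section Step.
Variable R : realType.

(** [saddleP] is affine in [v], so completing the square turns the proximal ascent step into a
    projection. *)
Lemma ascent_step_is_proj d l (Y : set 'cV[R]_l) loss (F : 'M[R]_(l, d))
    x y y' (s : R) : 0 < s ->
  is_argmax Y (fun v => saddleP loss F v x - (2 * s)^-1 * enorm (v - y) ^+ 2) y' ->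
  is_proj Y (y + s *: (F *m x)) y'.
Proof.
move=> s0 [Yy' ymax]; split=> // v Yv; rewrite ler_enorm.
have := ymax v Yv; rewrite /saddleP !sqr_enorm; set f := F *m x.
have e (u : 'cV[R]_l) : dotv (u - (y + s *: f)) (u - (y + s *: f)) =
    dotv (u - y) (u - y) - 2 * s * dotv u f + 2 * s * dotv y f + s ^+ 2 * dotv f f.
  rewrite opprD addrA (_ : dotv u f = dotv (u - y) f + dotv y f); last first.
    by rewrite -dotvDl subrK.
  by move: (u - y) => w; rewrite !dotvE (dotvC f w); ring.
rewrite !e => h.
have {}h : dotv v f - (2 * s)^-1 * dotv (v - y) (v - y) <=
           dotv y' f - (2 * s)^-1 * dotv (y' - y) (y' - y) by lra.
have s2 : 0 < 2 * s by lra.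
move: h; rewrite -(ler_pM2l s2) !mulrBr !mulrA mulfV ?gt_eqF// !mul1r; lra.
Qed.

(** The factor 1/8 lets the two cross terms together consume exactly the available [kappa / 4]. *)
Lemma young_eighth (kappa a b : R) : 0 < kappa ->
  a * b <= kappa / 8 * b ^+ 2 + 2 * a ^+ 2 / kappa.
Proof.
move=> k0; rewrite -(ler_pM2r k0) mulrDl divfK ?gt_eqF//.
have := sqr_ge0 (kappa * b - 4 * a); nra.
Qed.

(** Here [kappa] plays the role of [mu * (k + 2)], and [kappa / 4 + L / 2] is 1 / (2 beta) for the
    step-size beta. *)
Lemma saddle_gap_step d l (X : set 'cV[R]_d) (Y : set 'cV[R]_l)
    (F : 'M[R]_(l, d)) loss gradl (L mu lam s kappa Dy : R) G x x' xs y y' ys :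
  convex_set X -> convex_set Y ->
  0 <= L -> (forall x1 x2, X x1 -> X x2 ->
     enorm (gradl x1 - gradl x2) <= L * enorm (x1 - x2)) ->
  0 <= mu -> strongly_convex_on X loss gradl mu ->
  0 <= lam -> (forall w, dotv (F *m w) (F *m w) <= lam * dotv w w) ->
  0 < s -> 0 < kappa -> X x -> X xs -> Y ys -> enorm (ys - y') <= Dy ->
  is_proj Y (y + s *: (F *m x)) y' ->
  is_proj X (x - (2 / (kappa + 2 * L)) *: (G + F^T *m y')) x' ->
  saddleP loss F ys x' - saddleP loss F y' xs <=
    (2 * s)^-1 * (enorm (ys - y) ^+ 2 - enorm (ys - y') ^+ 2)
    + (kappa / 4 + L / 2) * (enorm (xs - x) ^+ 2 - enorm (xs - x') ^+ 2)
    - mu / 2 * enorm (xs - x) ^+ 2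
    - dotv (G - gradl x) (x - xs)
    + 2 * (lam * Dy ^+ 2 + enorm (G - gradl x) ^+ 2) / kappa.
Proof.
move=> cX cY L0 lip mu0 sc lam0 hlam s0 k0 Xx Xxs Yys uDy py px.
have Xx' := px.1.
have vy := proj_variational cY py Yys.
have vx := proj_variational cX px Xxs.
have desc := descent_lemma cX mu0 sc L0 lip Xx Xx'.
have scx := sc _ _ Xx Xxs.
have be0 : 0 < 2 / (kappa + 2 * L) by rewrite divr_gt0//; lra.
have [D DE] : exists D, D = x' - x by eexists.
have [del delE] : exists del, del = G - gradl x by eexists.
have [u uE] : exists u, u = ys - y' by eexists.
have D0 := enorm_ge0 D.
have I1 : dotv u (F *m D) <= kappa / 8 * enorm D ^+ 2 + 2 * (lam * Dy ^+ 2) / kappa.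
  apply: (le_trans (cauchy_schwarz _ _)).
  have hF : enorm (F *m D) <= Num.sqrt lam * enorm D.
    by rewrite /enorm -sqrtrM// ler_wsqrtr.
  apply: (@le_trans _ _ ((Dy * Num.sqrt lam) * enorm D)).
    by rewrite -mulrA; apply: ler_pM; rewrite ?enorm_ge0// uE.
  apply: (le_trans (young_eighth _ _ k0)).
  by rewrite exprMn (sqr_sqrtr lam0) [lam * _]mulrC.
have I2 : - dotv del D <= kappa / 8 * enorm D ^+ 2 + 2 * enorm del ^+ 2 / kappa.
  rewrite -dotvNl; apply: (le_trans (cauchy_schwarz _ _)); rewrite enormN.
  exact: young_eighth.
(* Three-point inequality of the dual projection, with the term in [|y' - y|^2] dropped. *)
have J1 : dotv u (F *m x) <=
    (2 * s)^-1 * (enorm (ys - y) ^+ 2 - enorm u ^+ 2).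
  have s2 : 0 < 2 * s by lra.
  rewrite -(ler_pM2l s2) mulrA mulfV ?gt_eqF// mul1r !sqr_enorm.
  have -> : ys - y = u + (y' - y) by rewrite uE addrA subrK.
  have := dotvv_ge0 (y' - y); move: vy; rewrite -uE.
  have -> : y + s *: (F *m x) - y' = s *: (F *m x) - (y' - y).
    by rewrite opprB addrAC (addrC _ (y - y')) addrC addrA.
  move: (y' - y) => w; rewrite !dotvE (dotvC w u) (dotvC (F *m x) u); lra.
(* The primal counterpart keeps [- |D|^2]: it pays for [L / 2] in the descent lemma and for both
   Young terms. *)
have J2 : dotv (G + F^T *m y') (x' - xs) <= (kappa / 4 + L / 2) *
    (enorm (xs - x) ^+ 2 - enorm (xs - x') ^+ 2 - enorm D ^+ 2).
  have -> : kappa / 4 + L / 2 = (2 * (2 / (kappa + 2 * L)))^-1 by field; lra.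
  move: (2 / _) be0 vx => be be0 vx.
  have b2 : 0 < 2 * be by lra.
  rewrite -(ler_pM2l b2) mulrA mulfV ?gt_eqF// mul1r !sqr_enorm.
  have -> : xs - x = (xs - x') + D by rewrite DE addrA subrK.
  move: vx; rewrite -(opprB xs x') addrAC -(opprB x' x) -DE.
  move: (xs - x') (G + F^T *m y') => w q.
  rewrite !dotvE (dotvC D w); lra.
move: J2 I1 I2 J1 desc scx; rewrite -delE -!uE -DE.
have -> : xs - x' = xs - x - D by rewrite DE opprB addrA subrK.
have GE : G = del + gradl x by rewrite delE subrK.
have xE : x' = x + D by rewrite DE addrC subrK.
have ysE : ys = u + y' by rewrite uE subrK.
rewrite /saddleP GE xE ysE mulmxDr !sqr_enorm.
rewrite -(opprB xs x) (_ : x + D - xs = D - (xs - x)); last first.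
  by rewrite opprB addrA (addrC D).
rewrite (_ : F *m xs = F *m x + F *m (xs - x)); last first.
  by rewrite -mulmxDr addrC subrK.
move: (xs - x) => e.
rewrite !dotvE -!dotv_mulmx (dotvC e (gradl x)).
move: (dotv del del) => dd; move: (dotv D D) => DD.
lra.
Qed.

Lemma weighted_gap_telescope (h a b m n : nat -> R) (s mu L A B C : R) :
  0 < s -> 0 < mu -> 0 <= L -> 0 <= C -> (forall k, 0 <= a k <= A) ->
  (forall k, 0 <= b k <= B) -> (forall k, 0 <= n k) ->
  (forall k, h k <= (2 * s)^-1 * (b k - b k.+1)
     + (mu * (k + 2)%:R / 4 + L / 2) * (a k - a k.+1) - mu / 2 * a k
     - m k + 2 * (C + n k) / (mu * (k + 2)%:R)) ->
  forall T, \sum_(k < T) k.+1%:R * h k <=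
    T%:R * ((2 * s)^-1 * B + L / 2 * A)
    + \sum_(k < T) (- (k.+1%:R * m k) + 2 / mu * (C + n k)).
Proof.
move=> s0 mu0 L0 C0 ha hb n0 hh T.
have is0 : 0 < (2 * s)^-1 by rewrite invr_gt0; lra.
(* Strengthened for induction: the bound retains the slacks [B - b T] and [A - a T], since the
   growing weights add one extra [b T] and [a T] per step, and the term in [mu] that telescopes
   exactly. *)
suff inv : \sum_(k < T) k.+1%:R * h k <=
    T%:R * ((2 * s)^-1 * (B - b T) + L / 2 * (A - a T))
    - mu / 4 * (T%:R * (T%:R + 1)) * a T
    + \sum_(k < T) (- (k.+1%:R * m k) + 2 / mu * (C + n k)).
  apply: (le_trans inv); rewrite lerD2r.
  have /andP[a0 _] := ha T; have /andP[b0 _] := hb T.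
  have T0 : 0 <= T%:R :> R by [].
  have : 0 <= mu / 4 * (T%:R * (T%:R + 1)) * a T.
    by rewrite mulr_ge0// mulr_ge0 ?mulr_ge0//; lra.
  have : 0 <= T%:R * ((2 * s)^-1 * b T + L / 2 * a T).
    by rewrite mulr_ge0// addr_ge0 ?mulr_ge0//; lra.
  lra.
elim: T => [|T IH]; first by rewrite !big_ord0 !(mul0r, mulr0) addr0 subr0.
rewrite !big_ord_recr/=.
have T0 : 0 <= T%:R :> R by [].
have T1 : 0 < T.+1%:R :> R by [].
have := ler_wpM2l (ltW T1) (hh T).
(* The weight [T + 1] cancels against the [T + 2] of the step-size, leaving an error independent of
   [T]. *)
have frac : T.+1%:R * (2 * (C + n T) / (mu * (T + 2)%:R)) <= 2 / mu * (C + n T).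
  have -> : T.+1%:R * (2 * (C + n T) / (mu * (T + 2)%:R)) =
    (2 / mu * (C + n T)) * (T.+1%:R / (T + 2)%:R).
    by field; rewrite ?gt_eqF//= natr1 addn2.
  apply: ler_piMr; first by rewrite mulr_ge0 ?addr_ge0// divr_ge0 ?ler0n// ltW.
  by rewrite addn2 ler_pdivrMr ?mul1r ?ler_nat// ltr0n.
have /andP[_ aA] := ha T; have /andP[_ bB] := hb T.
have p1 : 0 <= (2 * s)^-1 * (B - b T) by rewrite mulr_ge0 ?subr_ge0// ltW.
have p2 : 0 <= L / 2 * (A - a T) by rewrite mulr_ge0 ?divr_ge0 ?subr_ge0// ler0n.
move: IH frac; set S1 := \sum_(_ < _) _; set S2 := \sum_(_ < _) _.
rewrite natrD -(natr1 T).
move: (2 / mu * _) (2 * (C + n T) / _) => c q IH frac h1.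
have := lerD IH h1.
move: p1 p2 frac; move: T%:R T0 => t t0 p1 p2 frac.
move: (2 * s)^-1 p1 is0 => r p1 is0.
lra.
Qed.

End Step.

(** * Gradient noise *)

Lemma measurable_dotv (R : realType) dT (T : measurableType dT) n
    (f h : T -> 'cV[R]_n) :
  (forall i, measurable_fun setT (fun x => f x i 0)) ->
  (forall i, measurable_fun setT (fun x => h x i 0)) ->
  measurable_fun setT (fun x => dotv (f x) (h x)).
Proof.
move=> mf mh; apply: measurable_sum => i.
by apply: measurable_funM.
Qed.

Lemma measurable_mulmx (R : realType) dT (T : measurableType dT) m n
    (A : 'M[R]_(m, n)) (f : T -> 'cV[R]_n) :
  (forall i, measurable_fun setT (fun x => f x i 0)) ->
  forall i, measurable_fun setT (fun x => (A *m f x) i 0).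
Proof.
move=> mf i; apply: (eq_measurable_fun (fun x => \sum_j A i j * f x j 0)).
  by move=> x _; rewrite mxE.
by apply: measurable_sum => j; apply: measurable_funM.
Qed.

Section Noise.
Variables (R : realType) (d : nat) (X : set 'cV[R]_d).
Variable gradl : 'cV[R]_d -> 'cV[R]_d.
Variables (L : R) (dX : measure_display) (Xi : measurableType dX).
Variables (PXi : probability Xi R) (g : 'cV[R]_d -> Xi -> 'cV[R]_d).
Hypotheses (hXne : X !=set0) (hXc : compact X) (hXcv : convex_set X).
Hypothesis hL : 0 <= L.
Hypothesis hLip : forall x1 x2, X x1 -> X x2 ->
  enorm (gradl x1 - gradl x2) <= L * enorm (x1 - x2).
Hypothesis hgmeas : forall i : 'I_d,
  measurable_fun setT (fun p : (d.-tuple R * Xi)%type =>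
                         g (cv_of_tuple p.1) p.2 i 0).
Hypothesis hunb : forall x, X x -> forall i : 'I_d,
  PXi.-integrable setT (fun z => (g x z i 0)%:E) /\
  (\int[PXi]_z (g x z i 0)%:E = (gradl x i 0)%:E)%E.

(* Outside [X] the gradient is arbitrary; composing it with the projection
   makes the noise measurable without changing it on [X]. *)
Definition noise (v : 'cV[R]_d) (z : Xi) : 'cV[R]_d := g v z - gradl (eproj X v).

Lemma noiseE v z : X v -> noise v z = g v z - gradl v.
Proof.
move=> Xv; rewrite /noise; congr (_ - gradl _).
symmetry; apply: is_proj_eq => //; split=> // q Xq.
by rewrite subrr {1}/enorm dotv0l sqrtr0 enorm_ge0.
Qed.

Lemma measurable_noise i :
  measurable_fun setT (fun p : (d.-tuple R * Xi)%type =>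
                         noise (cv_of_tuple p.1) p.2 i 0).
Proof.
have mG : measurable_fun setT
    (fun t : d.-tuple R => gradl (eproj X (cv_of_tuple t)) i 0).
  apply: (@measurable_continuous_cv R d (fun v => gradl (eproj X v) i 0)).
  apply: (@lipschitz_proj_continuous R d X (fun v => gradl v i 0) L) => //.
  move=> u v Xu Xv.
  apply: le_trans (hLip Xu Xv); apply: le_trans (coord_le_enorm _ i).
  by rewrite !mxE.
have := measurable_funB (hgmeas i) (measurableT_comp mG measurable_fst).
by apply: eq_measurable_fun => p _; rewrite /= /noise !mxE.
Qed.

Lemma integral_noise_dot v u : X v ->
  (\int[PXi]_z (dotv (noise v z) u)%:E = 0)%E.
Proof.
move=> Xv.
under eq_integral => z _ do rewrite noiseE// /dotv -sumEFin.
have int1 i : PXi.-integrable setT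
    (fun z => ((g v z i 0)%:E - (gradl v i 0)%:E)%E).
  apply: integrableB => //; first exact: (hunb Xv i).1.
  exact: finite_measure_integrable_cst.
have int2 i : PXi.-integrable setT
    (fun z => ((g v z - gradl v) i 0 * u i 0)%:E).
  have := integrableZl measurableT (u i 0) (int1 i).
  apply: eq_integrable => // z _.
  by rewrite /= !mxE mulrC EFinM EFinB.
rewrite integral_sum// big1// => i _.
under eq_integral => z _ do rewrite !mxE mulrC EFinM EFinB.
rewrite integralZl// integralB//; first last.
- exact: finite_measure_integrable_cst.
- exact: (hunb Xv i).1.
rewrite (hunb Xv i).2 integral_cst//=.
rewrite (_ : PXi setT = 1%E) ?mule1 ?subee ?mule0//; exact: probability_setT.
Qed.

End Noise.

(** * The convergence bound in expectation *)

Theorem theorem5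
  (R : realType) (d l : nat)
  (* feasible sets *)
  (X : set 'cV[R]_d) (Y : set 'cV[R]_l)
  (hXne : X !=set0) (hXc : compact X) (hXcv : convex_set X)
  (hYne : Y !=set0) (hYc : compact Y) (hYcv : convex_set Y)
  (F : 'M[R]_(l, d))
  (* loss, its gradient, smoothness and strong convexity *)
  (loss : 'cV[R]_d -> R) (gradl : 'cV[R]_d -> 'cV[R]_d) (L mu : R)
  (hgrad : gradient_on X loss gradl)
  (hconv : convex_on X loss)
  (hL : 0 <= L)
  (hLip : forall x1 x2, X x1 -> X x2 ->
            enorm (gradl x1 - gradl x2) <= L * enorm (x1 - x2))
  (hmu : 0 < mu) (hsc : strongly_convex_on X loss gradl mu)
  (* sample space, sample law and stochastic gradient oracle *)
  (dX : measure_display) (Xi : measurableType dX) (PXi : probability Xi R)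
  (g : 'cV[R]_d -> Xi -> 'cV[R]_d) (sigma : R)
  (hgmeas : forall i : 'I_d,
     measurable_fun setT (fun p : (d.-tuple R * Xi)%type =>
                            g (cv_of_tuple p.1) p.2 i 0))
  (hsigma : 0 < sigma)
  (hunb : forall x, X x -> forall i : 'I_d,
     PXi.-integrable setT (fun z => (g x z i 0)%:E) /\
     (\int[PXi]_z (g x z i 0)%:E = (gradl x i 0)%:E)%E)
  (hvar : forall x, X x ->
     (\int[PXi]_z ((enorm (g x z - gradl x)) ^+ 2)%:E <= (sigma ^+ 2)%:E)%E)
  (hsubg : forall x, X x ->
     (\int[PXi]_z (expR (enorm (g x z - gradl x) ^+ 2 / sigma ^+ 2))%:E
        <= (expR 1)%:E)%E)
  (* underlying probability space and i.i.d. samples; xi k is xi^{k+1} *)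
  (dO : measure_display) (Omega : measurableType dO) (P : probability Omega R)
  (xi : nat -> Omega -> Xi)
  (hximeas : forall k, measurable_fun setT (xi k))
  (hxilaw : forall k (A : set Xi), measurable A -> P (xi k @^-1` A) = PXi A)
  (hind : mutually_independent P xi)
  (* SPDHG *)
  (s : R) (hs : 0 < s)
  (x0 : 'cV[R]_d) (y0 : 'cV[R]_l) (hx0 : X x0) (hy0 : Y y0)
  (x : nat -> Omega -> 'cV[R]_d) (y : nat -> Omega -> 'cV[R]_l)
  (hinit : forall w, x 0%N w = x0 /\ y 0%N w = y0)
  (hyupd : forall k w,
     is_argmax Y (fun v => saddleP loss F v (x k w)
                           - (2 * s)^-1 * enorm (v - y k w) ^+ 2) (y k.+1 w))
  (hxupd : forall k w,
     is_proj X (x k w - (2 / (mu * (k + 2)%:R + 2 * L)) *: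
                         (g (x k w) (xi k w) + F^T *m y k.+1 w))
             (x k.+1 w))
  (* a saddle point *)
  (ys : 'cV[R]_l) (xs : 'cV[R]_d) (hys : Y ys) (hxs : X xs)
  (hsaddle : forall v u, Y v -> X u ->
     saddleP loss F v xs <= saddleP loss F ys xs <= saddleP loss F ys u) :
  forall t : nat,
  let alpha (k : nat) : R := (2 * k.+1%:R) / (t.+1%:R * t.+2%:R) in
  let xbar (w : Omega) := \sum_(k < t.+1) alpha k *: x k.+1 w in
  let ybar (w : Omega) := \sum_(k < t.+1) alpha k *: y k.+1 w in
  (0 <= \int[P]_w (saddleP loss F ys (xbar w) - saddleP loss F (ybar w) xs)%:E
     <= (diam Y ^+ 2 / (s * t.+2%:R) + L * diam X ^+ 2 / t.+2%:R
         + (4 * lambda_max (F^T *m F) * diam Y ^+ 2 + 4 * sigma ^+ 2)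
           / (mu * t.+2%:R))%:E)%E.

Proof.
have [lam0 hlam] := lambda_max_gram F.
set lam := lambda_max _ in lam0 hlam *.
have Xx k w : X (x k w).
  by case: k => [|k]; [rewrite (hinit w).1|exact: (hxupd k w).1].
have Yy k w : Y (y k w).
  by case: k => [|k]; [rewrite (hinit w).2|exact: (hyupd k w).1].
have py k w := ascent_step_is_proj hs (hyupd k w).
(* The iterates form a Markov chain driven by the samples, which makes
   [x k] independent of [xi k]. *)
pose S k w : (d.-tuple R * l.-tuple R)%type :=
  (tuple_of_cv (x k w), tuple_of_cv (y k w)).
pose xc (p : (d.-tuple R * l.-tuple R) * Xi) := cv_of_tuple p.1.1.
pose yn (p : (d.-tuple R * l.-tuple R) * Xi) :=
  eproj Y (cv_of_tuple p.1.2 + s *: (F *m xc p)).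
pose xn k (p : (d.-tuple R * l.-tuple R) * Xi) :=
  eproj X (xc p - (2 / (mu * (k + 2)%:R + 2 * L)) *:
                    (g (xc p) p.2 + F^T *m yn p)).
pose Phi k p : (d.-tuple R * l.-tuple R)%type :=
  (tuple_of_cv (xn k p), tuple_of_cv (yn p)).
have mxc i : measurable_fun setT (fun p => xc p i 0).
  apply: (eq_measurable_fun (fun p => tnth p.1.1 i)).
    by move=> p _; rewrite mxE.
  apply: (@measurableT_comp _ _ _ _ _ _ (fun t : d.-tuple R => tnth t i)).
    exact: measurable_tnth.
  exact: measurableT_comp.
have myn i : measurable_fun setT (fun p => yn p i 0).
  apply: (measurable_comp_cv (h := fun v => eproj Y v i 0)
    (f := fun p => cv_of_tuple p.1.2 + s *: (F *m xc p))) => [|j].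
    exact: proj_coord_continuous.
  apply: (eq_measurable_fun (fun p : (d.-tuple R * l.-tuple R) * Xi =>
      tnth p.1.2 j + s * (F *m xc p) j 0)).
    by move=> p _; rewrite !mxE.
  apply: measurable_funD.
    apply: (@measurableT_comp _ _ _ _ _ _ (fun t : l.-tuple R => tnth t j)).
      exact: measurable_tnth.
    exact: measurableT_comp.
  by apply: measurable_funM => //; exact: measurable_mulmx.
have mxz : measurable_fun setT
    (fun p : (d.-tuple R * l.-tuple R) * Xi => (p.1.1, p.2)).
  by apply: measurable_fun_pair => //; exact: measurableT_comp.
have mxn k i : measurable_fun setT (fun p => xn k p i 0).
  apply: (measurable_comp_cv (h := fun v => eproj X v i 0)
    (f := fun p => xc p - (2 / (mu * (k + 2)%:R + 2 * L)) *:
                    (g (xc p) p.2 + F^T *m yn p))) => [|j].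
    exact: proj_coord_continuous.
  apply: (eq_measurable_fun (fun p => xc p j 0 - 2 / (mu * (k + 2)%:R + 2 * L) *
      (g (xc p) p.2 j 0 + (F^T *m yn p) j 0))).
    by move=> p _; rewrite !mxE.
  apply: measurable_funB => //; apply: measurable_funM => //.
  apply: measurable_funD; last exact: measurable_mulmx.
  exact: (measurableT_comp (hgmeas j) mxz).
have mPhi k : measurable_fun setT (Phi k).
  by apply: measurable_fun_pair; exact: measurable_tuple_of_cv.
have S0 w : S 0%N w = (tuple_of_cv x0, tuple_of_cv y0).
  by rewrite /S (hinit w).1 (hinit w).2.
(* Uniqueness of projections turns the relational updates into one measurable map of state and
   sample. *)
have Snext k w : S k.+1 w = Phi k (S k w, xi k w).
  rewrite /S /Phi /xn /yn /xc/= !tuple_of_cvK.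
  rewrite -(is_proj_eq hYcv hYne hYc (py k w)).
  by rewrite -(is_proj_eq hXcv hXne hXc (hxupd k w)).

(* Moments of the gradient noise along the iterates *)
pose del k w := g (x k w) (xi k w) - gradl (x k w).
pose N k w := enorm (del k w) ^+ 2.
pose M k w := dotv (del k w) (x k w - xs).
pose nz (p : (d.-tuple R * l.-tuple R) * Xi) := noise X gradl g (xc p) p.2.
have mnz i : measurable_fun setT (fun p => nz p i 0).
  exact: (measurableT_comp (measurable_noise hXne hXc hXcv hL hLip hgmeas i) mxz).
have nzS k w z : nz (S k w, z) = g (x k w) z - gradl (x k w).
  by rewrite /nz /xc/= tuple_of_cvK noiseE.
pose fN p := (dotv (nz p) (nz p))%:E.
pose fM p := (dotv (nz p) (xc p - xs))%:E.
have mfN : measurable_fun setT fN by apply/measurable_EFinP; exact: measurable_dotv.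
have mfM : measurable_fun setT fM.
  apply/measurable_EFinP; apply: measurable_dotv => // i.
  apply: (eq_measurable_fun (fun p => xc p i 0 - xs i 0)).
    by move=> p _; rewrite !mxE.
  exact: measurable_funB.
have mZ k : measurable_fun setT (fun w => (S k w, xi k w)).
  by apply: measurable_fun_pair => //; exact: (chain_measurable hximeas mPhi S0 Snext).
have NE k w : (N k w)%:E = fN (S k w, xi k w) by rewrite /fN nzS -sqr_enorm.
have ME k w : (M k w)%:E = fM (S k w, xi k w).
  by rewrite /fM nzS /xc/= tuple_of_cvK.
have EN k : (\int[P]_w (N k w)%:E <= (sigma ^+ 2)%:E)%E.
  under eq_integral => w _ do rewrite NE.
  rewrite (chain_fubini_ge0 hximeas hxilaw hind mPhi S0 Snext)//; last first.
    by move=> p; rewrite lee_fin dotvv_ge0.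
  (* Writing [sigma ^+ 2] as an integral over [Omega] reduces the claim to the variance bound at
     each frozen state. *)
  rewrite -[leRHS]mule1 -(@probability_setT _ _ _ P) -integral_cst//.
  apply: ge0_le_integralT => w.
    by apply: integral_ge0 => z _; rewrite lee_fin dotvv_ge0.
  apply: le_trans (hvar _ (Xx k w)).
  by under eq_integral => z _ do rewrite /fN nzS -sqr_enorm.
have intN k : P.-integrable setT (fun w => (N k w)%:E).
  apply/integrableP; split.
    by under eq_fun do rewrite NE; exact: measurableT_comp mfN (mZ k).
  under eq_integral => w _ do rewrite gee0_abs ?lee_fin ?sqr_ge0//.
  exact: le_lt_trans (EN k) (ltry _).
have intM k : P.-integrable setT (fun w => (M k w)%:E).
  (* Integrable majorant of [M k], from Cauchy-Schwarz and [a * b <= a ^+ 2 + b ^+ 2]. *)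
  have intB : P.-integrable setT (fun w => ((N k w)%:E + (diam X ^+ 2)%:E)%E).
    by apply: integrableD => //; exact: finite_measure_integrable_cst.
  apply: le_integrable intB => //.
    by under eq_fun do rewrite ME; exact: measurableT_comp mfM (mZ k).
  move=> w _; rewrite -EFinD !abse_EFin lee_fin.
  have D1 := enorm_le_diam hXc (Xx k w) hxs.
  have c1 := cauchy_schwarz (del k w) (x k w - xs).
  have c2 := cauchy_schwarz (- del k w) (x k w - xs).
  rewrite [leRHS]ger0_norm ?addr_ge0 ?sqr_ge0// ler_norml.
  move: c1 c2; rewrite enormN dotvNl -/(M k w) /N.
  move: (enorm_ge0 (del k w)) (enorm_ge0 (x k w - xs)) D1.
  move: (enorm _) (enorm _) => b a a0 b0 bD c1 c2.
  have ab : a * b <= a ^+ 2 + diam X ^+ 2.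
    have b2 : b ^+ 2 <= diam X ^+ 2.
      by rewrite ler_pXn2r ?nnegrE// (le_trans b0).
    have -> : a * b = (a ^+ 2 + b ^+ 2 - (a - b) ^+ 2) / 2 by field.
    have := sqr_ge0 (a - b); have := sqr_ge0 a; have := sqr_ge0 (diam X); lra.
  by apply/andP; split; lra.
have EM k : (\int[P]_w (M k w)%:E = 0)%E.
  under eq_integral => w _ do rewrite ME.
  rewrite (chain_fubini hximeas hxilaw hind mPhi S0 Snext)//; last first.
    by apply: eq_integrable (intM k) => // w _; rewrite ME.
  apply: integral0_eq => w _.
  rewrite /fM /nz /xc/= tuple_of_cvK.
  exact: integral_noise_dot.

(* Averaging with the weights and taking expectations *)
move=> t.
pose alpha (k : nat) : R := (2 * k.+1%:R) / (t.+1%:R * t.+2%:R).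
pose xbar (w : Omega) := \sum_(k < t.+1) alpha k *: x k.+1 w.
pose ybar (w : Omega) := \sum_(k < t.+1) alpha k *: y k.+1 w.
suff : (0 <= \int[P]_w (saddleP loss F ys (xbar w) - saddleP loss F (ybar w) xs)%:E
     <= (diam Y ^+ 2 / (s * t.+2%:R) + L * diam X ^+ 2 / t.+2%:R
         + (4 * lam * diam Y ^+ 2 + 4 * sigma ^+ 2) / (mu * t.+2%:R))%:E)%E by [].
have t1 : 0 < t.+1%:R :> R by [].
have t2 : 0 < t.+2%:R :> R by [].
(* The weights [alpha k] are [k + 1] normalised, the shape expected by the convexity lemmas. *)
pose c : R := (\sum_(k < t.+1) k.+1%:R)^-1.
have cE : c = 2 / (t.+1%:R * t.+2%:R).
  rewrite /c; suff -> n : \sum_(k < n) k.+1%:R = n%:R * n.+1%:R / 2 :> R.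
    by rewrite invf_div.
  elim: n => [|n IH]; first by rewrite big_ord0 !mul0r.
  by rewrite big_ord_recr/= IH -(natr1 n.+1) -(natr1 n); field.
have c0 : 0 < c by rewrite cE divr_gt0// mulr_gt0.
have alphaE k : alpha k = c * k.+1%:R by rewrite /alpha cE; field; rewrite !gt_eqF.
have xbarE w : xbar w = c *: \sum_(k < t.+1) k.+1%:R *: x k.+1 w.
  by rewrite scaler_sumr; apply: eq_bigr => k _; rewrite alphaE scalerA.
have ybarE w : ybar w = c *: \sum_(k < t.+1) k.+1%:R *: y k.+1 w.
  by rewrite scaler_sumr; apply: eq_bigr => k _; rewrite alphaE scalerA.
have Xbar w : X (xbar w).
  rewrite xbarE; exact: (convex_set_sum t hXcv (fun k => ltr0Sn R k)
    (fun k => Xx k.+1 w)).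
have Ybar w : Y (ybar w).
  rewrite ybarE; exact: (convex_set_sum t hYcv (fun k => ltr0Sn R k)
    (fun k => Yy k.+1 w)).
have gap_ge0 w : 0 <= saddleP loss F ys (xbar w) - saddleP loss F (ybar w) xs.
  by have /andP[] := hsaddle _ _ (Ybar w) (Xbar w); lra.
pose gap k w := saddleP loss F ys (x k.+1 w) - saddleP loss F (y k.+1 w) xs.
(* Jensen in [x]; in [y] the function is affine, so averaging gives an equality. *)
have jensen w : saddleP loss F ys (xbar w) - saddleP loss F (ybar w) xs <=
    c * \sum_(k < t.+1) k.+1%:R * gap k w.
  have cvx : convex_on X (saddleP loss F ys).
    move=> u v Xu Xv th th01; have := hconv _ _ Xu Xv _ th01.
    by rewrite /saddleP mulmxDr -!scalemxAr !dotvE; lra.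
  have := convex_on_sum t hXcv cvx (fun k => ltr0Sn R k) (fun k => Xx k.+1 w).
  rewrite -/c -xbarE => hx.
  have hy : saddleP loss F (ybar w) xs =
      c * \sum_(k < t.+1) k.+1%:R * saddleP loss F (y k.+1 w) xs.
    rewrite /saddleP ybarE dotvZl dotv_suml.
    under [in RHS]eq_bigr do rewrite mulrDr -dotvZl.
    rewrite big_split/= mulrDr -mulr_suml mulrA mulVf ?mul1r//.
    by rewrite gt_eqF// -invr_gt0.
  rewrite hy; apply: (le_trans (lerB hx (lexx _))).
  by rewrite -mulrBr -sumrB; under eq_bigr do rewrite -mulrBr.
pose C := lam * diam Y ^+ 2.
have C0 : 0 <= C by rewrite mulr_ge0 ?sqr_ge0.
have sqdiam n (Q : set 'cV[R]_n) u v : compact Q -> Q u -> Q v ->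
    0 <= enorm (u - v) ^+ 2 <= diam Q ^+ 2.
  move=> cQ Qu Qv; have uv := enorm_le_diam cQ Qu Qv.
  by rewrite sqr_ge0/= ler_pXn2r ?nnegrE ?enorm_ge0// (le_trans (enorm_ge0 _) uv).
have tel w := @weighted_gap_telescope R (gap^~ w)
  (fun k => enorm (xs - x k w) ^+ 2) (fun k => enorm (ys - y k w) ^+ 2)
  (M^~ w) (N^~ w) s mu L (diam X ^+ 2) (diam Y ^+ 2) C hs hmu hL C0
  (fun k => sqdiam _ _ _ _ hXc hxs (Xx k w))
  (fun k => sqdiam _ _ _ _ hYc hys (Yy k w)) (fun k => sqr_ge0 _).
pose q := c * (2 / mu).
have q0 : 0 <= q by rewrite mulr_ge0 ?divr_ge0// ltW.
(* The deterministic part of the bound, separated from the noise terms before integration. *)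
pose K := c * (t.+1%:R * ((2 * s)^-1 * diam Y ^+ 2 + L / 2 * diam X ^+ 2))
  + t.+1%:R * (q * C).
have upper w : saddleP loss F ys (xbar w) - saddleP loss F (ybar w) xs <=
    K + \sum_(k < t.+1) (- (c * k.+1%:R) * M k w + q * N k w).
  apply: (le_trans (jensen w)).
  apply: (@le_trans _ _ (c * (t.+1%:R *
      ((2 * s)^-1 * diam Y ^+ 2 + L / 2 * diam X ^+ 2)
    + \sum_(k < t.+1) (- (k.+1%:R * M k w) + 2 / mu * (C + N k w))))).
    rewrite ler_pM2l//; apply: tel => k.
    have k0 : 0 < mu * (k + 2)%:R by rewrite mulr_gt0// ltr0n addn2.
    exact: (saddle_gap_step hXcv hYcv hL hLip (ltW hmu) hsc lam0 hlam hs k0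
      (Xx k w) hxs hys (enorm_le_diam hYc hys (Yy k.+1 w)) (py k w) (hxupd k w)).
  rewrite mulrDr /K -addrA lerD2l mulr_sumr.
  rewrite (_ : t.+1%:R * (q * C) = \sum_(k < t.+1) q * C); last first.
    by rewrite sumr_const card_ord mulr_natl.
  by rewrite -big_split/= le_eqVlt; apply/orP; left; apply/eqP;
    apply: eq_bigr => k _; rewrite /q; ring.
rewrite integral_ge0/=; last by move=> w _; rewrite lee_fin.
apply: (@le_trans _ _ (\int[P]_w (K%:E + \sum_(k < t.+1)
    ((- (c * k.+1%:R))%:E * (M k w)%:E + q%:E * (N k w)%:E)))%E).
  apply: ge0_le_integralT => w; first by rewrite lee_fin.
  under eq_bigr do rewrite -!EFinM -EFinD.
  by rewrite sumEFin -EFinD lee_fin.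
have int1 k : P.-integrable setT (fun w =>
    ((- (c * k.+1%:R))%:E * (M k w)%:E + q%:E * (N k w)%:E)%E).
  by apply: integrableD => //; exact: integrableZl.
rewrite integralD//; [|exact: finite_measure_integrable_cst|
  by apply: integrable_sum => // k _; exact: int1].
rewrite integral_cst//= (_ : P setT = 1%E) ?mule1; last exact: probability_setT.
rewrite integral_sum//.
apply: (@le_trans _ _ (K%:E + \sum_(k < t.+1) (q * sigma ^+ 2)%:E)%E).
  rewrite leeD2l//; apply: lee_sum => k _.
  rewrite integralD//; [|exact: integrableZl|exact: integrableZl].
  rewrite !integralZl// EM mule0 add0e (EFinM q).
  by apply: lee_wpmul2l; rewrite ?lee_fin.
(* The constants now match with equality, since [c * (t + 1) = 2 / (t + 2)]. *)
rewrite sumEFin -EFinD lee_fin sumr_const card_ord -mulr_natl /K /q cE /C.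
rewrite le_eqVlt; apply/orP; left; apply/eqP; field.
by rewrite !gt_eqF.
Qed.
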